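(* Let $(a_n)_{n\ge1}$ and $(\lambda_n)_{n\ge1}$ be sequences of positive real numbers, and define $\Lambda_n=\sum_{i=1}^n\lambda_i$ and $A_n=\sum_{i=1}^n\lambda_i a_i$. Then for all real numbers $p,q_1,q_2$ with $0<q_1\le q_2\le p$, $$\sum_{n=1}^\infty\lambda_n\left(\frac{A_n}{\Lambda_n}\right)^{-p+q_1}a_n^{-q_1}\le\left(\frac{p+1}{p}\right)^{q_2-q_1}\sum_{n=1}^\infty\lambda_n\left(\frac{A_n}{\Lambda_n}\right)^{-p+q_2}a_n^{-q_2}.$$
   Context: Series of nonnegative terms take values in $[0,+\infty]$, and the inequality is understood in $[0,+\infty]$. *)

(* Defs.v *)
From HB Require Import structures.
From mathcomp Require Import all_boot all_order all_algebra.
From mathcomp Require Import all_classical all_reals all_analysis.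
Set Implicit Arguments.
Unset Strict Implicit.
Unset Printing Implicit Defensive.
Import Order.TTheory GRing.Theory Num.Theory.
Local Open Scope ring_scope.

(* Sequences indexed by n >= 1 are functions on nat whose value at 0 is never
   used. *)

Definition weight_sum (R : realType) (lam : nat -> R) (n : nat) : R :=
  \sum_(1 <= i < n.+1) lam i.

Definition weighted_sum (R : realType) (lam a : nat -> R) (n : nat) : R :=
  \sum_(1 <= i < n.+1) lam i * a i.

(* Main.v *)
Require Import Defs.
From HB Require Import structures.
From mathcomp Require Import all_boot all_order all_algebra.
From mathcomp Require Import all_classical all_reals all_analysis.
From mathcomp Require Import ring lra.
Set Implicit Arguments.
Unset Strict Implicit.
Unset Printing Implicit Defensive.
Import Order.TTheory GRing.Theory Num.Theory.
Local Open Scope ring_scope.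

(** The inequality holds between the partial sums with the same number of
    terms, and passes to the limit because the terms are nonnegative.  Write
    [b n = A n / L n] for the weighted mean of [a], where [L n] is the sum of
    the weights, and [c = (p + 1) / p].  The [n]-th term with exponent [q] is
    [lam n * b n ^ (- p) * (b n / a n) ^ q], so with [s = c * b n / a n] the
    difference between the two sides is, up to the constant factor
    [c ^ (- q1)], a sum of [lam n * b n ^ (- p) * (s ^ q2 - s ^ q1)].

    The function [s ^ q2 - s ^ q1] lies above [(q2 - q1) * (1 - 1 / s)], which
    touches it at [s = 1] ([powR_diff_ge]).  Since [1 / s = a n / (c * b n)]
    is linear in [a n], this bound leaves only the nonnegativity of the sum of
    [lam n * b n ^ (- p) * (c - a n / b n)].  Here [lam n * a n] is the
    increment [L n * b n - L n.-1 * b n.-1], and the case [q1 = 0], [q2 = p]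
    of the same elementary inequality ([powR_sub1_ge]), now at
    [s = b n / b n.-1], shows that each summand is at least the increment of
    [L n * b n ^ (- p) / p] ([mean_step]).  The sum telescopes
    ([mean_telescope]). *)

Section RealInequalities.
Variable R : realType.
Implicit Types (s k p q L l a u v : R).

(** Insert [k * ln s] between the two sides: [s ^ k - 1 >= k * ln s], as
    [exp] lies above its tangent at [0], and [ln s = - ln (1 / s)] is at least
    [1 - 1 / s], as [ln] lies below its tangent at [1]. *)
Lemma powR_sub1_ge s k : 0 < s -> 0 <= k -> k * (1 - s^-1) <= s `^ k - 1.
Proof.
move=> s_gt0 k_ge0.
have ln_ge : 1 - s^-1 <= ln s.
  have := le_ln1Dx (x := s^-1 - 1).
  rewrite [1 + _]addrC subrK lnV ?posrE // ltrBrDr addNr invr_gt0 => /(_ s_gt0).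
  lra.
apply: (le_trans (ler_wpM2l k_ge0 ln_ge)).
rewrite /powR gt_eqF // lerBrDr addrC.
exact: expR_ge1Dx.
Qed.

(** Factor [s ^ q1 * (s ^ (q2 - q1) - 1)]: the factor [s ^ q1] may be dropped
    because [s ^ q1 - 1] and [s ^ (q2 - q1) - 1] have the same sign. *)
Lemma powR_diff_ge s q1 q2 : 0 < s -> 0 <= q1 -> q1 <= q2 ->
  (q2 - q1) * (1 - s^-1) <= s `^ q2 - s `^ q1.
Proof.
move=> s_gt0 q1_ge0 q12.
have k_ge0 : 0 <= q2 - q1 by rewrite subr_ge0.
apply: (le_trans (powR_sub1_ge s_gt0 k_ge0)).
have -> : s `^ q2 = s `^ q1 * s `^ (q2 - q1).
  by rewrite -powRD ?(gt_eqF s_gt0) ?implybT // addrC subrK.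
have [s_ge1|s_lt1] := leP 1 s.
  have := ler_powR s_ge1 q1_ge0; have := ler_powR s_ge1 k_ge0.
  rewrite !powRr0; nra.
have s01 : 0 < s <= 1 by rewrite s_gt0 ltW.
have := ger_powR s01 q1_ge0; have := ger_powR s01 k_ge0.
rewrite !powRr0; nra.
Qed.

(** One step of the telescoping: adding a value [a] of weight [l] to values of
    total weight [L] and mean [u] changes their mean to [v].  The difference
    of the two sides is exactly [L * v ^ (- p) / p] times the slack of
    [powR_sub1_ge] at [s = v / u]. *)
Lemma mean_step L l a u v p : 0 < p -> 0 <= L -> 0 < u -> 0 < v ->
  (L + l) * v = L * u + l * a ->
  (L + l) * v `^ (- p) / p <=
  L * u `^ (- p) / p + l * v `^ (- p) * ((p + 1) / p - a / v).
Proof.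
move=> p_gt0 L_ge0 u_gt0 v_gt0 mean_v.
have := powR_sub1_ge (divr_gt0 v_gt0 u_gt0) (ltW p_gt0).
have V_gt0 : 0 < v `^ (- p) by rewrite powR_gt0.
have -> : (v / u) `^ p = u `^ (- p) / v `^ (- p).
  by rewrite powRM ?invr_ge0 ?ltW // -powR_inv1 ?ltW // -powRrM mulN1r
             [v `^ (- p)]powRN invrK mulrC.
rewrite invf_div => step.
have scale_ge0 : 0 <= L * v `^ (- p) / p.
  by rewrite !mulr_ge0 ?invr_ge0 // ltW.
have := ler_wpM2l scale_ge0 step.
set U := u `^ (- p); set V := v `^ (- p) in V_gt0 step scale_ge0 *.
have -> : L * V / p * (p * (1 - u / v)) = L * V - V / v * (L * u).
  by field; rewrite !gt_eqF.
have -> : L * V / p * (U / V - 1) = L * U / p - L * V / p.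
  by field; rewrite !gt_eqF.
have -> : l * V * ((p + 1) / p - a / v) = l * V + l * V / p - V / v * (l * a).
  by field; rewrite !gt_eqF.
have : V / v * ((L + l) * v) = (L + l) * V by field; rewrite gt_eqF.
rewrite mean_v; lra.
Qed.

End RealInequalities.

Section Means.
Variables (R : realType) (a lam : nat -> R).
Hypothesis a_gt0 : forall n, (1 <= n)%N -> 0 < a n.
Hypothesis lam_gt0 : forall n, (1 <= n)%N -> 0 < lam n.

Let mean n := weighted_sum lam a n / weight_sum lam n.

Lemma weight_sum_gt0 n : (1 <= n)%N -> 0 < weight_sum lam n.
Proof.
case: n => // n _; rewrite /weight_sum big_nat_recr //=.
rewrite ltr_wpDl ?lam_gt0 // big_nat_cond sumr_ge0 // => i.
by rewrite andbT => /andP[i_ge1 _]; rewrite ltW // lam_gt0.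
Qed.

Lemma weighted_sum_gt0 n : (1 <= n)%N -> 0 < weighted_sum lam a n.
Proof.
case: n => // n _; rewrite /weighted_sum big_nat_recr //=.
rewrite ltr_wpDl ?mulr_gt0 ?lam_gt0 ?a_gt0 // big_nat_cond sumr_ge0 // => i.
by rewrite andbT => /andP[i_ge1 _]; rewrite ltW // mulr_gt0 ?lam_gt0 ?a_gt0.
Qed.

Lemma mean_gt0 n : (1 <= n)%N -> 0 < mean n.
Proof. by move=> n1; rewrite divr_gt0 ?weighted_sum_gt0 ?weight_sum_gt0. Qed.

(** What is used later is that the sum is nonnegative; the sharper bound is the
    form that survives induction. *)
Lemma mean_telescope p n : 0 < p ->
  weight_sum lam n * mean n `^ (- p) / p <=
  \sum_(1 <= i < n.+1) lam i * mean i `^ (- p) * ((p + 1) / p - a i / mean i).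
Proof.
move=> p_gt0; elim: n => [|n IHn].
  by rewrite /weight_sum !big_geq // !mul0r.
rewrite [leRHS]big_nat_recr //=; apply: le_trans (lerD IHn (lexx _)).
have weightS : weight_sum lam n.+1 = weight_sum lam n + lam n.+1.
  by rewrite /weight_sum big_nat_recr.
have meanS : (weight_sum lam n + lam n.+1) * mean n.+1 =
             weighted_sum lam a n + lam n.+1 * a n.+1.
  rewrite -weightS /mean mulrC divfK ?gt_eqF ?weight_sum_gt0 //.
  by rewrite /weighted_sum big_nat_recr.
rewrite weightS.
case: n => [|n] in IHn weightS meanS *; last first.
  apply: mean_step; rewrite ?mean_gt0 ?(ltW (weight_sum_gt0 _)) //.
  by rewrite meanS [in RHS]mulrC divfK // gt_eqF ?weight_sum_gt0.
(* [mean 0] is [0 / 0 = 0], where a positive mean is required; as it comes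
   with the weight [0], any positive number can stand in for it. *)
have W0 : weight_sum lam 0 = 0 by rewrite /weight_sum big_geq.
have := @mean_step R 0 (lam 1%N) (a 1%N) 1 (mean 1%N) p p_gt0 (lexx _) ltr01.
rewrite W0 !mul0r; apply; first exact: mean_gt0.
by move: meanS; rewrite W0 /weighted_sum big_geq.
Qed.

Let term p q n := lam n * mean n `^ (- p + q) * a n `^ (- q).

Lemma term_ge0 p q n : (1 <= n)%N -> 0 <= term p q n.
Proof. by move=> n1; rewrite !mulr_ge0 ?powR_ge0 // ltW ?lam_gt0. Qed.

(** This is [powR_diff_ge] at [s = c * mean n / a n], scaled by
    [lam n * mean n ^ (- p) * c ^ (- q1)]. *)
Lemma term_diff_ge p q1 q2 c n : 0 < c -> 0 <= q1 -> q1 <= q2 -> (1 <= n)%N ->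
  c `^ (- q1) * (q2 - q1) / c * (lam n * mean n `^ (- p) * (c - a n / mean n))
  <= c `^ (q2 - q1) * term p q2 n - term p q1 n.
Proof.
move=> c_gt0 q1_ge0 q12 n1.
rewrite /term; have := mean_gt0 n1; move: (mean n) => b b_gt0.
move: (a n) (lam n) (a_gt0 n1) (lam_gt0 n1) => x l x_gt0 l_gt0.
have s_gt0 : 0 < c * (b / x) by rewrite mulr_gt0 ?divr_gt0.
have termE q : l * b `^ (- p + q) * x `^ (- q) =
    l * b `^ (- p) * c `^ (- q) * (c * (b / x)) `^ q.
  have -> : (c * (b / x)) `^ q = c `^ q * b `^ q * x `^ (- q).
    rewrite !powRM ?invr_ge0 ?divr_ge0 ?ltW // -[x^-1]powR_inv1 ?ltW //.
    by rewrite -powRrM mulN1r mulrA.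
  rewrite powRD ?(gt_eqF b_gt0) ?implybT // [c `^ (- q)]powRN.
  by field; rewrite gt_eqF ?powR_gt0.
rewrite (termE q1) (termE q2).
have -> : c `^ (q2 - q1) = c `^ q2 * c `^ (- q1).
  by rewrite powRD // (gt_eqF c_gt0) implybT.
rewrite [c `^ (- q2)]powRN.
have cq2 : c `^ q2 != 0 by rewrite gt_eqF ?powR_gt0.
have w_ge0 : 0 <= l * b `^ (- p) * c `^ (- q1).
  by rewrite !mulr_ge0 ?powR_ge0 ?ltW.
have := ler_wpM2l w_ge0 (powR_diff_ge s_gt0 q1_ge0 q12).
congr (_ <= _).
  by field; rewrite !gt_eqF.
by field.
Qed.

Lemma partial_sum_le p q1 q2 N : 0 < p -> 0 <= q1 -> q1 <= q2 ->
  \sum_(1 <= n < N) term p q1 n <=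
  ((p + 1) / p) `^ (q2 - q1) * \sum_(1 <= n < N) term p q2 n.
Proof.
move=> p_gt0 q1_ge0 q12; case: N => [|N]; first by rewrite !big_geq ?mulr0.
set c := (p + 1) / p.
have c_gt0 : 0 < c by rewrite divr_gt0 ?ltr_wpDl ?ltW.
rewrite -subr_ge0 mulr_sumr -sumrB.
have diff_ge : c `^ (- q1) * (q2 - q1) / c *
    (\sum_(1 <= n < N.+1) lam n * mean n `^ (- p) * (c - a n / mean n))
    <= \sum_(1 <= n < N.+1) (c `^ (q2 - q1) * term p q2 n - term p q1 n).
  rewrite mulr_sumr !big_nat; apply: ler_sum => n /andP[n1 _].
  exact: term_diff_ge.
apply: le_trans diff_ge; rewrite mulr_ge0 //.
  by rewrite !mulr_ge0 ?powR_ge0 ?subr_ge0 // invr_ge0 ltW.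
apply: le_trans (mean_telescope N p_gt0).
case: N => [|N]; first by rewrite /weight_sum big_geq // !mul0r.
by rewrite !mulr_ge0 ?powR_ge0 ?invr_ge0 ?(ltW p_gt0) ?(ltW (weight_sum_gt0 _)).
Qed.

End Means.

Theorem theorem4 (R : realType) (a lam : nat -> R)
    (a_gt0 : forall n, (1 <= n)%N -> 0 < a n)
    (lam_gt0 : forall n, (1 <= n)%N -> 0 < lam n)
    (p q1 q2 : R) (q1_gt0 : 0 < q1) (q1_le_q2 : q1 <= q2) (q2_le_p : q2 <= p) :
  (\sum_(1 <= n <oo)
     (lam n * (weighted_sum lam a n / weight_sum lam n) `^ (- p + q1)
            * a n `^ (- q1))%:E
   <= (((p + 1) / p) `^ (q2 - q1))%:E *
      \sum_(1 <= n <oo)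
        (lam n * (weighted_sum lam a n / weight_sum lam n) `^ (- p + q2)
               * a n `^ (- q2))%:E)%E.
Proof.
have p_gt0 : 0 < p := lt_le_trans q1_gt0 (le_trans q1_le_q2 q2_le_p).
have ge0 := term_ge0 a lam_gt0 p.
apply: lime_le => [|].
  by apply: is_cvg_ereal_nneg_natsum => n n1; rewrite lee_fin ge0.
apply: nearW => N.
have := partial_sum_le a_gt0 lam_gt0 N p_gt0 (ltW q1_gt0) q1_le_q2.
rewrite -lee_fin EFinM -!sumEFin => /le_trans; apply.
rewrite lee_pmul2l // ?lte_fin; last first.
  by rewrite powR_gt0 // divr_gt0 ?ltr_wpDl ?ltW.
by apply: nneseries_lim_ge => n n1 _; rewrite lee_fin ge0.
Qed.
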